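(* For every natural number $r\ge 1$ there exists a constant $c(r)$, depending only on $r$, such that for every natural number $n$, $$H(r,n)\leq \frac{1}{2^r r!}\,d(n)^r+c(r)\,d(n)^{r-1}.$$
   Context: For $f\in\mathbb{Z}[x]$, $(f)_r$ denotes the coefficient of $x^r$ in $f$ (equal to $0$ if $r>\deg f$). For natural numbers $r,n$, define $H(r,n)=\max\{|(g)_r| : g\in\mathbb{Z}[x],\ g\mid (x^n-1)\}$. $d(n)$ denotes the number of positive divisors of $n$. *)

(* Defs.v *)
From mathcomp Require Import all_boot all_order all_algebra all_field.
From mathcomp Require Import boolp classical_sets cardinality fsbigop reals.

Set Implicit Arguments.
Unset Strict Implicit.
Unset Printing Implicit Defensive.

Import Order.TTheory GRing.Theory Num.Theory.

Local Open Scope ring_scope.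

(* Divisibility in the ring Z[x].  MathComp's [%|] on [{poly int}] is
   pseudo-divisibility, i.e. divisibility in Q[x], and is not used here. *)
Definition zpoly_dvd (g f : {poly int}) : Prop := exists h, f = h * g.

Definition coef_values (r n : nat) : set nat :=
  [set `|(g`_r)%R|%N | g in [set g : {poly int} | zpoly_dvd g ('X^n - 1)]].

(* A maximum over a set is a finitely supported big operator, with value 0 when
   the set is infinite; this happens only for n = 0, see [H_max]. *)
Definition H (r n : nat) : nat :=
  \big[maxn/0%N]_(k \in coef_values r n) k.

Lemma coef_prod_XsubC_le (s : seq algC) (i : nat) :
  (forall z, z \in s -> `|z| = 1) ->
  `|(\prod_(z <- s) ('X - z%:P))`_i| <= 2 ^+ size s.
Proof.
elim: s i => [|z s IHs] i s1.
  by rewrite big_nil coef1; case: (i == 0)%N; rewrite ?normr1 ?normr0 ?ler01.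
rewrite big_cons mulrBl coefB coefXM coefCM /= exprS mulr_natl mulr2n.
have IH j := IHs j (fun y ys => s1 y (mem_behead (s := z :: s) ys)).
apply: (le_trans (ler_normB _ _)); apply: lerD.
  by case: ifP => _; rewrite ?IH // normr0 exprn_ge0 ?ler0n.
by rewrite normrM (s1 z) ?mem_head // mul1r IH.
Qed.

Lemma coef_zpoly_dvd_le (n r : nat) (g : {poly int}) :
  (0 < n)%N -> zpoly_dvd g ('X^n - 1) -> (`|(g`_r)%R| <= 2 ^ n)%N.
Proof.
move=> n0 [h eq_hg].
have Xn1_neq0 : 'X^n - 1 != 0 :> {poly int} by rewrite monic_neq0 ?monicXnsubC.
have [h0 g0] : h != 0 /\ g != 0.
  by apply/andP; move: Xn1_neq0; rewrite eq_hg mulf_eq0 negb_or.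
have lead1 : `|lead_coef g|%N = 1%N.
  apply/eqP; have : lead_coef h * lead_coef g = 1.
    by rewrite -lead_coefM -eq_hg; apply/monicP; rewrite monicXnsubC.
  by move/(congr1 absz)/eqP; rewrite abszM muln_eq1 => /andP[].
pose gC := map_poly (intr : int -> algC) g.
have [s eq_gC] := closed_field_poly_normal gC.
have lead_gC : lead_coef gC = (lead_coef g)%:~R.
  by rewrite lead_coef_map_inj //; apply: intr_inj.
have normlead : `|lead_coef gC| = 1.
  by rewrite lead_gC -intr_norm -abszE lead1.
have sz_g : (size g <= n.+1)%N.
  rewrite -(size_XnsubC (1 : int) n0) eq_hg size_mul //.
  by rewrite -size_poly_gt0 in h0; case: (size h) h0 => // m _; rewrite addSn leq_addl.
have sz_s : (size s <= n)%N.
  rewrite -ltnS (leq_trans _ sz_g) // -(size_map_inj_poly (f := intr : int -> algC)) //;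
    last exact: intr_inj.
  rewrite -/gC eq_gC size_scale ?size_prod_XsubC //.
  by rewrite -normr_eq0 normlead oner_eq0.
have s1 z : z \in s -> `|z| = 1.
  move=> zs; have rootz : root gC z.
    by rewrite eq_gC rootE hornerZ -/(root _ _) (eqP (_ : root _ z)) ?mulr0 // root_prod_XsubC.
  have : (map_poly (intr : int -> algC) ('X^n - 1)).[z] = 0.
    by rewrite eq_hg rmorphM hornerM -/gC (eqP rootz) mulr0.
  rewrite rmorphB /= map_polyXn rmorph1 !hornerE => /eqP.
  rewrite subr_eq0 => /eqP /(congr1 Num.norm); rewrite normrX normr1 => /eqP.
  by rewrite pexpr_eq1 ?normr_ge0 // => /eqP.
have : `|gC`_r| <= 2 ^+ n.
  rewrite eq_gC coefZ normrM normlead mul1r.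
  apply: (le_trans (coef_prod_XsubC_le r s1)).
  by rewrite ler_weXn2l ?ler1n.
by rewrite coef_map /= -intr_norm -abszE -natrX -pmulrn ler_nat.
Qed.

Lemma finite_coef_values (r n : nat) : (0 < n)%N -> finite_set (coef_values r n).
Proof.
move=> n0; apply: (@sub_finite_set _ _ `I_(2 ^ n).+1); last exact: finite_II.
by move=> _ [g gdvd <-] /=; rewrite ltnS coef_zpoly_dvd_le.
Qed.

Lemma H_max (r n : nat) : (0 < n)%N ->
  coef_values r n (H r n) /\ (forall k, coef_values r n k -> (k <= H r n)%N).
Proof.
move=> n0; have fin := finite_coef_values r n0.
have Hub k : coef_values r n k -> (k <= H r n)%N.
  move=> vk; rewrite /H fsbig_finite //=.
  by apply: (leq_bigmax_seq k) => //; rewrite in_fset_set // inE.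
split=> //.
have v0 : coef_values r n `|((1 : {poly int})`_r)%R|%N.
  by exists 1 => //; exists ('X^n - 1); rewrite mulr1.
have : coef_values r n (H r n) \/ H r n = 0%N.
  rewrite /H fsbig_finite //= big_seq.
  apply: (big_ind (fun m => coef_values r n m \/ m = 0%N)); first by right.
  - by move=> x y vx vy; rewrite /maxn; case: ifP.
  - by move=> k; rewrite in_fset_set // inE; left.
case=> // H0; have := Hub _ v0.
by rewrite H0 leqn0 => /eqP v00; rewrite -v00.
Qed.

(* Main.v *)
(* Let p_k be the sum of the k-th powers of the inverses of the complex roots of
   g.  Comparing coefficients in g' = - g * (\sum_(k >= 1) p_k X^(k-1)) gives
   (r + 1) g_(r+1) = - \sum_(i <= r) p_(i+1) g_(r-i).  If g divides X^n - 1, its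
   roots are the primitive d-th roots of unity for d in some set S of divisors
   of n, so p_k is the sum over d in S of the Ramanujan sums c_d(k).  These are
   bounded in terms of k alone, and p_1 = \sum_(d in S) mu(d) satisfies
   2 |p_1| <= d(n) + 1, because \sum_(d | n) mu(d) is 0 or 1 and therefore
   2 p_1 differs by at most 1 from \sum_(d in S) mu(d) - \sum_(d notin S) mu(d).
   Induction on r: only the term p_1 g_r reaches the order d(n)^(r+1), and it
   contributes a factor d(n) / (2 (r + 1)). *)
Require Import Defs.
From mathcomp Require Import all_boot all_order all_algebra all_field.
From mathcomp Require Import reals ring lra.

Set Implicit Arguments.
Unset Strict Implicit.
Unset Printing Implicit Defensive.

Import Order.TTheory GRing.Theory Num.Theory.

Local Open Scope ring_scope.

(** * Moebius function and Moebius inversion *)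

Definition moebius (n : nat) : int :=
  if all (fun p => logn p n == 1%N) (primes n) then (-1) ^+ size (primes n)
  else 0.

Lemma normr_moebius_le1 (n : nat) : `|moebius n| <= 1.
Proof. by rewrite /moebius; case: ifP;
  rewrite ?normr0 // normrX normrN1 expr1n. Qed.

Lemma moebius_pmul (p n : nat) : prime p -> (0 < n)%N ->
  moebius (p * n) = if (p %| n)%N then 0 else - moebius n.
Proof.
move=> p_pr n0; have p0 := prime_gt0 p_pr.
have prE : primes (p * n) =i p :: primes n.
  by move=> q; rewrite primesM // primes_prime // mem_seq1 inE.
have lognE q : logn q (p * n) = ((q == p) + logn q n)%N.
  by rewrite lognM // logn_prime // eq_sym.
rewrite /moebius (eq_all_r prE) /= lognE eqxx add1n eqSS.
case: (boolP (p %| n)%N) => [dvd_pn | ndvd_pn].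
  have : (0 < logn p n)%N by rewrite logn_gt0 mem_primes p_pr n0 dvd_pn.
  by case: (logn p n).
have pnotin : p \notin primes n by rewrite mem_primes (negPf ndvd_pn) !andbF.
rewrite -[logn p n == _]negbK -lt0n logn_gt0 pnotin /=.
have -> : all (fun q => logn q (p * n) == 1%N) (primes n)
       = all (fun q => logn q n == 1%N) (primes n).
  apply: eq_in_all => q qn; rewrite lognE.
  by case: (q =P p) qn pnotin => [-> ->|].
have /perm_size -> : perm_eq (primes (p * n)) (p :: primes n).
  by apply: uniq_perm; rewrite ?primes_uniq //= pnotin primes_uniq.
by case: ifP; rewrite ?oppr0 //= exprS mulN1r.
Qed.

(** For n > 1 write n = p m with p prime. A divisor p e of n contributes 0 if p | e and minus the
    Moebius value of e otherwise; the divisors of n prime to p are the divisors of m prime to p, so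
    everything cancels. *)
Lemma sum_moebius (n : nat) : (0 < n)%N ->
  \sum_(d <- divisors n) moebius d = (n == 1%N)%:R.
Proof.
move=> n0; case: eqVneq => [->|n1]; first by rewrite big_seq1.
have [p p_pr /dvdnP[m Dn]] : {p | prime p & (p %| n)%N}.
  by apply: pdivP; rewrite ltn_neqAle eq_sym n1.
have [m0 p0] : (0 < m)%N /\ (0 < p)%N by apply/andP; rewrite -muln_gt0 -Dn.
rewrite (bigID (dvdn p)) /=.
have -> : \sum_(d <- divisors n | (p %| d)%N) moebius d
        = \sum_(e <- divisors m) moebius (p * e).
  rewrite -(big_map (muln p) xpredT moebius) -[LHS]big_filter; apply: perm_big.
  apply: uniq_perm; first by rewrite filter_uniq ?divisors_uniq.
    rewrite map_inj_uniq ?divisors_uniq // => x y /eqP.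
    by rewrite eqn_pmul2l // => /eqP.
  move=> d; rewrite mem_filter -dvdn_divisors //; apply/andP/mapP.
    case=> /dvdnP[e ->]; rewrite Dn dvdn_pmul2r // => em.
    by exists e; rewrite -?dvdn_divisors // mulnC.
  case=> e; rewrite -dvdn_divisors // => em ->.
  by rewrite dvdn_mulr // Dn mulnC dvdn_pmul2r.
rewrite big_seq (eq_bigr (fun e => if (p %| e)%N then 0 else - moebius e));
  last first.
  by move=> e; rewrite -dvdn_divisors // => em;
    rewrite moebius_pmul ?(dvdn_gt0 m0).
rewrite -big_seq (bigID (dvdn p)) /= big1 ?add0r; last by move=> e ->.
rewrite (eq_bigr (fun e => - moebius e)); last by move=> e /negPf->.
rewrite sumrN addrC; apply/eqP; rewrite subr_eq0; apply/eqP.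
rewrite -big_filter -[RHS]big_filter; apply: perm_big.
apply: uniq_perm; rewrite ?filter_uniq ?divisors_uniq // => d.
rewrite !mem_filter -!dvdn_divisors //; case: (boolP (p %| d)%N) => //= pd.
by rewrite Dn Gauss_dvdl // coprime_sym prime_coprime.
Qed.

Lemma moebius_inversion (V : zmodType) (F G : nat -> V) (n : nat) : (0 < n)%N ->
  (forall m, (m %| n)%N -> \sum_(d <- divisors m) F d = G m) ->
  F n = \sum_(e <- divisors n) G e *~ moebius (n %/ e).
Proof.
move=> n0 FG.
rewrite big_seq; under eq_bigr => e en.
  rewrite -FG ?dvdn_divisors // mulrz_suml.
  have -> : \sum_(d <- divisors e) F d *~ moebius (n %/ e)
          = \sum_(d <- divisors n | (d %| e)%N) F d *~ moebius (n %/ e).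
    rewrite -[RHS]big_filter; apply: perm_big; apply: uniq_perm;
      rewrite ?filter_uniq ?divisors_uniq // => d.
    rewrite -dvdn_divisors // in en.
    rewrite mem_filter -!dvdn_divisors ?(dvdn_gt0 n0) //.
    by case: (boolP (d %| e)%N) => //= /dvdn_trans->.
  over.
rewrite -big_seq /= (exchange_big_dep xpredT) //=.
(* As e runs over the multiples of d dividing n, n / e runs over the divisors of n / d. *)
have inner d : d \in divisors n ->
    \sum_(e <- divisors n | (d %| e)%N) F d *~ moebius (n %/ e)
    = F d *~ (n == d)%:R.
  rewrite -dvdn_divisors // => dn; have d0 := dvdn_gt0 n0 dn.
  have nd0 : (0 < n %/ d)%N by rewrite divn_gt0 // dvdn_leq.
  rewrite -mulrz_sumr; congr (_ *~ _).
  have -> : (n == d) = (n %/ d == 1)%N by rewrite -eqn_mul // mul1n.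
  rewrite -sum_moebius //.
  rewrite -big_filter -(big_map (divn n) xpredT moebius); apply: perm_big.
  have divnnK e : (e %| n)%N -> (n %/ (n %/ e))%N = e.
    move=> en; rewrite -[n in (n %/ (_ %/ _))%N](divnK en) mulKn //.
    by rewrite divn_gt0 ?(dvdn_gt0 n0) // dvdn_leq.
  apply: uniq_perm; rewrite ?divisors_uniq //.
    rewrite map_inj_in_uniq ?filter_uniq ?divisors_uniq // => x y.
    rewrite !mem_filter -!dvdn_divisors // => /andP[_ xn] /andP[_ yn]
      /(congr1 (divn n)).
    by rewrite !divnnK.
  move=> f; rewrite -dvdn_divisors //; apply/mapP/idP.
    case=> e; rewrite mem_filter -dvdn_divisors // => /andP[de en] ->.
    by rewrite dvdn_divRL // -[X in (_ %| X)%N](divnK en) dvdn_mul.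
  move=> fnd; have fn : (f %| n)%N by apply: dvdn_trans fnd (dvdn_div _).
  exists (n %/ f)%N; last by rewrite divnnK.
  rewrite mem_filter -dvdn_divisors // dvdn_div // dvdn_divRL // mulnC.
  by rewrite -dvdn_divRL // fnd.
rewrite big_seq (eq_bigr _ inner) -big_seq (bigD1_seq n) ?divisors_uniq
  -?dvdn_divisors //=.
rewrite eqxx mulr1z big1 ?addr0 // => d; rewrite eq_sym => /negPf->.
by rewrite mulr0z.
Qed.

(** * Power sums of the inverses of the roots *)

Section InversePowerSums.
Variable C : closedFieldType.
Implicit Types (f g : {poly C}) (s : seq C) (k : nat).

Definition roots_of f : seq C := sval (closed_field_poly_normal f).

(** Inverses are taken so that Newton's identities produce the coefficients from the constant term
    upwards. *)
Definition inv_psum k f : C := \sum_(z <- roots_of f) z^-1 ^+ k.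

Lemma roots_ofE f : f = lead_coef f *: \prod_(z <- roots_of f) ('X - z%:P).
Proof. by rewrite /roots_of; case: closed_field_poly_normal. Qed.

Lemma perm_roots_of c s : c != 0 ->
  perm_eq (roots_of (c *: \prod_(z <- s) ('X - z%:P))) s.
Proof.
move=> c0; set f := c *: _; apply: prod_XsubC_eq; apply: (scalerI c0).
rewrite -/f [RHS]roots_ofE; congr (_ *: _).
by rewrite lead_coefZ (monicP (monic_prod_XsubC _ _ _)) mulr1.
Qed.

Lemma inv_psum_prod_XsubC k c s : c != 0 ->
  inv_psum k (c *: \prod_(z <- s) ('X - z%:P)) = \sum_(z <- s) z^-1 ^+ k.
Proof. by move=> c0; apply/perm_big/perm_roots_of. Qed.

Lemma inv_psumM k f g : f != 0 -> g != 0 ->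
  inv_psum k (f * g) = inv_psum k f + inv_psum k g.
Proof.
move=> f0 g0; rewrite {1}(roots_ofE f) {1}(roots_ofE g) -scalerAl -scalerAr
  scalerA.
by rewrite -big_cat inv_psum_prod_XsubC ?big_cat // mulf_neq0 ?lead_coef_eq0.
Qed.

Lemma inv_psum_polyC k c : c != 0 -> inv_psum k c%:P = 0.
Proof.
by move=> c0; have := inv_psum_prod_XsubC k [::] c0; rewrite !big_nil alg_polyC.
Qed.

Lemma inv_psum_prod k (I : Type) (r : seq I) (P : pred I) (F : I -> {poly C}) :
  (forall i, F i != 0) ->
  inv_psum k (\prod_(i <- r | P i) F i) = \sum_(i <- r | P i) inv_psum k (F i).
Proof.
move=> F0; elim: r => [|i r IHr];
  first by rewrite !big_nil inv_psum_polyC ?oner_eq0.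
rewrite !big_cons; case: ifP => // _; rewrite inv_psumM ?IHr //.
by apply: (big_ind (fun f => f != 0)) => [|f g|j _];
  [exact: oner_neq0 | exact: mulf_neq0 |].
Qed.

End InversePowerSums.

(** * Logarithmic derivatives and Newton's identities *)

(* [log_deriv f p] says that f' = - f * (\sum_i p_i X^i) as power series. *)
Definition log_deriv (R : nzRingType) (f : {poly R}) (p : nat -> R) : Prop :=
  forall r, (f^`())`_r = - \sum_(i < r.+1) p i * f`_(r - i).

Lemma log_derivC (R : nzRingType) (c : R) : log_deriv c%:P (fun=> 0).
Proof. by move=> r; rewrite derivC coef0 big1 ?oppr0 // => i _; rewrite mul0r.
Qed.

Lemma log_derivM (R : comNzRingType) (f g : {poly R}) (p q : nat -> R) :
  log_deriv f p -> log_deriv g q -> log_deriv (f * g) (fun i => p i + q i).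
Proof.
move=> fp gq r.
(* Cutting the series after degree r turns it into a polynomial and does not affect coefficients up
   to r. *)
have trunc (h : {poly R}) s j : log_deriv h s -> (j <= r)%N ->
    (h^`())`_j = - (\poly_(i < r.+1) s i * h)`_j.
  move=> hs jr; rewrite hs coefM; congr (- _); apply: eq_bigr => i _.
  by rewrite coef_poly ltnS (leq_trans (leq_ord i) jr).
have dmul (h : {poly R}) s e : log_deriv h s ->
    (h^`() * e)`_r = - (\poly_(i < r.+1) s i * (h * e))`_r.
  move=> hs; rewrite mulrA !coefM -sumrN; apply: eq_bigr => j _.
  by rewrite (trunc h s) ?leq_ord // mulNr.
rewrite derivM coefD (dmul f p) // [f * g^`()]mulrC (dmul g q) // [g * f]mulrC.
rewrite -opprD !coefM -big_split; congr (- _); apply: eq_bigr => i _ /=.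
by rewrite !coef_poly ltn_ord mulrDl.
Qed.

(** Geometric series: 1 / (z - X) is the sum of the z^-(i+1) X^i. *)
Lemma log_deriv_XsubC (F : fieldType) (z : F) : z != 0 ->
  log_deriv ('X - z%:P) (fun i => z^-1 ^+ i.+1).
Proof.
move=> z0 r; rewrite derivB derivX derivC subr0 coef1.
have cX j : ('X - z%:P)`_j = (j == 1%N)%:R - (if j == 0%N then z else 0).
  by rewrite coefB coefX coefC.
case: r => [|r]; first by rewrite big_ord1 cX /= sub0r mulrN mulVf ?opprK.
rewrite !big_ord_recr /= big1 ?add0r => [|i _]; last first.
  by rewrite cX subSn ?(ltnW (ltn_ord i)) //= eqSS subn_eq0 leqNgt ltn_ord
    subr0 mulr0.
by rewrite !cX subSnn subnn /= subr0 sub0r mulr1 mulrN [z^-1 ^+ r.+2]exprSr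
  mulfVK // subrr oppr0.
Qed.

(** Logarithmic derivatives add over the linear factors; a nonzero constant term makes every root
    invertible. *)
Lemma coef_deriv_inv_psum (C : closedFieldType) (f : {poly C}) :
  f`_0 != 0 -> log_deriv f (fun i => inv_psum i.+1 f).
Proof.
move=> f0 r; pose c := lead_coef f; pose s := roots_of f.
have c0 : c != 0 by rewrite lead_coef_eq0; apply: contraNneq f0 => ->;
  rewrite coef0.
have s0 z : z \in s -> z != 0.
  apply: contraTneq => ->; rewrite -root_prod_XsubC /root horner_coef0.
  by move: f0; rewrite {1}(roots_ofE f) coefZ mulf_eq0 negb_or => /andP[].
suff: log_deriv (c *: \prod_(z <- s) ('X - z%:P))
  (fun i => \sum_(z <- s) z^-1 ^+ i.+1).
  by rewrite -roots_ofE; apply.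
elim: s s0 => [|z s IHs] s0 {r}r.
  rewrite big_nil alg_polyC log_derivC; congr (- _); apply: eq_bigr => i _.
  by rewrite big_nil.
rewrite big_cons scalerAr (log_derivM (log_deriv_XsubC _) (IHs _)) ?s0
  ?mem_head //.
  by congr (- _); apply: eq_bigr => i _; rewrite big_cons.
by move=> y ys; apply: s0; rewrite inE ys orbT.
Qed.

(** * Power sums of roots of unity and Ramanujan sums *)

Lemma inv_psum_Xn_sub_1 (C : closedFieldType) (n k : nat) (z : C) :
  n.-primitive_root z -> (0 < k)%N ->
  inv_psum k ('X^n - 1 : {poly C}) = (if (n %| k)%N then n else 0%N)%:R.
Proof.
move=> prim_z k0.
rewrite -(factor_Xn_sub_1 prim_z)
  -(big_map (GRing.exp z) xpredT (fun z => 'X - z%:P)) /=.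
rewrite -[\prod_(_ <- _) _]scale1r inv_psum_prod_XsubC ?oner_eq0 // big_map
  big_mkord.
rewrite (eq_bigr (fun i : 'I_n => (z^-1 ^+ k) ^+ i)); last first.
  by move=> i _; rewrite -exprVn -!exprM mulnC.
(* The sum is geometric with ratio w: it is n if w = 1, and vanishes otherwise because w^n = 1. *)
set w := z^-1 ^+ k; have w1 : (w == 1) = (n %| k)%N.
  by rewrite /w exprVn invr_eq1 (prim_order_dvd prim_z).
case: ifP => dv.
  rewrite (eq_bigr (fun=> 1)) ?sumr_const ?card_ord // => i _.
  by move/eqP: (etrans w1 dv) => ->; rewrite expr1n.
have wn : w ^+ n = 1.
  by rewrite /w -exprM mulnC exprM exprVn (prim_expr_order prim_z) invr1 expr1n.
apply/eqP; have /esym/eqP := subrX1 w n; rewrite wn subrr.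
by rewrite mulf_eq0 subr_eq0 w1 dv.
Qed.

(** Kluyver's formula for the Ramanujan sum c_n(k). *)
Definition ramanujan (k n : nat) : int :=
  \sum_(e <- divisors n | (e %| k)%N) e%:Z * moebius (n %/ e).

(** X^m - 1 is the product of the Phi_d with d | m, so their power sums add up to m if m | k and to
    0 otherwise; Moebius inversion isolates Phi_n. *)
Lemma inv_psum_Cyclotomic (k n : nat) : (0 < k)%N -> (0 < n)%N ->
  inv_psum k (map_poly intr 'Phi_n : {poly algC}) = (ramanujan k n)%:~R.
Proof.
move=> k0 n0; pose F d : algC := inv_psum k
  (map_poly intr 'Phi_d : {poly algC}).
rewrite -/(F n) (@moebius_inversion _ F (fun m => (if (m %| k)%N then m else
  0%N)%:R)) //.
  rewrite /ramanujan [in RHS]big_mkcond rmorph_sum /=; apply: eq_bigr => e _.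
  by case: ifP; rewrite ?mul0rz // rmorphM /= mulrzr.
move=> m mn; have m0 := dvdn_gt0 n0 mn.
have [z prim_z] := C_prim_root_exists m0.
rewrite -(inv_psum_Xn_sub_1 prim_z k0) /F -inv_psum_prod; last first.
  by move=> d; apply/monic_neq0/monic_map/Cyclotomic_monic.
by rewrite -rmorph_prod /= prod_Cyclotomic // rmorphB /= map_polyXn rmorph1.
Qed.

Lemma ramanujan1 (n : nat) : (0 < n)%N -> ramanujan 1 n = moebius n.
Proof.
move=> n0; rewrite /ramanujan -big_filter (@perm_big _ _ _ _ _ [:: 1%N]).
  by rewrite big_seq1 mul1r divn1.
apply: uniq_perm; rewrite ?filter_uniq ?divisors_uniq // => e.
by rewrite mem_filter dvdn1 mem_seq1 -dvdn_divisors //;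
  case: (e =P 1%N) => // ->; rewrite dvd1n.
Qed.

(** Only divisors e of k occur, each with a term of size at most e, so the bound is uniform in n. *)
Lemma normr_ramanujan_le (k n : nat) : (0 < k)%N ->
  `|ramanujan k n| <= (\sum_(e < k.+1) e)%:Z.
Proof.
move=> k0; rewrite /ramanujan -big_filter;
  apply: (le_trans (ler_norm_sum _ _ _)).
have le_nat : (\sum_(e <- [seq e <- divisors n | (e %| k)%N]) e
              <= \sum_(e <- index_iota 0 k.+1) e)%N.
  apply: uniq_sub_le_big => //; first by move=> x y; rewrite leq_addr.
  - by rewrite filter_uniq ?divisors_uniq.
  - exact: iota_uniq.
  by move=> e; rewrite mem_filter mem_index_iota ltnS => /andP[/(dvdn_leq k0)].
rewrite -(big_mkord xpredT id); move: le_nat; rewrite -lez_nat; apply: le_trans.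
rewrite (big_morph Posz PoszD (erefl _)); apply: ler_sum => e _.
by rewrite normrM ler_piMr ?normr_moebius_le1.
Qed.

(** The gain of a factor 2 over the trivial bound is the source of 2^r in the theorem. *)
Lemma normr_sum_moebius_le (n : nat) (P : pred nat) : (0 < n)%N ->
  `|\sum_(d <- divisors n | P d) moebius d| *+ 2 <= (size (divisors n)).+1%:Z.
Proof.
move=> n0; have := sum_moebius n0; rewrite (bigID P) /=.
set s := \sum_(d <- _ | P d) _; set t := \sum_(d <- _ | ~~ P d) _ => st.
have -> : `|s| *+ 2 = `|(s - t) + (n == 1%N)%:R|.
  by rewrite -st addrCA subrK -mulr2n normrMn.
have st_le : `|s - t| <= (size (divisors n))%:Z.
  have -> : s - t = \sum_(d <- divisors n)
    (if P d then moebius d else - moebius d).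
    by rewrite [RHS](bigID P) /= -sumrN; congr (_ + _); apply: eq_bigr => d;
      [move=> -> | move=> /negPf->].
  apply: (le_trans (ler_norm_sum _ _ _)).
  apply: (@le_trans _ _ (\sum_(d <- divisors n) 1)).
    by apply: ler_sum => d _; case: ifP; rewrite ?normrN normr_moebius_le1.
  by rewrite big_const_seq count_predT iter_addr_0 natz.
apply: (le_trans (ler_normD _ _)); rewrite intS [leRHS]addrC lerD //.
by case: (n == 1%N).
Qed.

(** * Roots of the divisors of X^n - 1 *)

Lemma mem_roots_of (C : closedFieldType) (f : {poly C}) (z : C) :
  f != 0 -> (z \in roots_of f) = root f z.
Proof.
by move=> f0; rewrite [in RHS](roots_ofE f) rootZ ?lead_coef_eq0 //
  root_prod_XsubC.
Qed.

Lemma uniq_roots_of (C : closedFieldType) (f : {poly C}) :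
  separable_poly f -> uniq (roots_of f).
Proof.
rewrite -separable_prod_XsubC; apply: dvdp_separable.
by rewrite [X in _ %| X]roots_ofE -mul_polyC dvdp_mull.
Qed.

Lemma root_Cyclotomic (d : nat) (z : algC) : (0 < d)%N ->
  root (map_poly intr 'Phi_d) z = d.-primitive_root z.
Proof.
move=> d0; have [w prim_w] := C_prim_root_exists d0.
by rewrite (Cintr_Cyclotomic prim_w) root_cyclotomic.
Qed.

(* Irreducibility of cyclotomic polynomials over Q, in terms of roots. *)
Lemma root_primitive_eq (g : {poly int}) (d : nat) (z w : algC) :
  d.-primitive_root z -> d.-primitive_root w ->
  root (map_poly intr g) z = root (map_poly intr g) w.
Proof.
move=> prim_z prim_w.
have -> : map_poly intr g = map_poly ratr (map_poly intr g : {poly rat}) :>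
  {poly algC}.
  by rewrite -map_poly_comp; apply: eq_map_poly => x /=; rewrite ratr_int.
have [p [minz _] ->] := minCpolyP z; have [q [minw _] ->] := minCpolyP w.
suff -> : p = q by [].
apply: (map_inj_poly (fmorph_inj (ratr : rat -> algC)) (rmorph0 _)).
by rewrite -minz -minw !(minCpoly_cyclotomic prim_z, minCpoly_cyclotomic prim_w)
  -(Cintr_Cyclotomic prim_z) -(Cintr_Cyclotomic prim_w).
Qed.

Lemma zpoly_dvd_log_deriv (n : nat) (g : {poly int}) :
  (0 < n)%N -> zpoly_dvd g ('X^n - 1) ->
  exists P : pred nat,
    log_deriv g (fun i => \sum_(d <- divisors n | P d) ramanujan i.+1 d).
Proof.
move=> n0 [h Dh].
pose G := map_poly intr g : {poly algC}.
have dvG : G %| 'X^n - 1.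
  apply/dvdpP; exists (map_poly intr h).
  by rewrite -rmorphM -Dh rmorphB /= map_polyXn rmorph1.
have XnN0 : 'X^n - 1 != 0 :> {poly algC} by rewrite monic_neq0 ?monicXnsubC.
have sepXn : @separable_poly algC ('X^n - 1).
  by rewrite separable_Xn_sub_1 // pnatr_eq0 -lt0n.
pose Phi d := map_poly intr 'Phi_d : {poly algC}.
have Phi0 d : Phi d != 0 by apply/monic_neq0/monic_map/Cyclotomic_monic.
pose P d := has (root G) (roots_of (Phi d)); exists P.
(* By irreducibility, one primitive d-th root of unity among the roots of G forces all of them. *)
have rootGE d z : d.-primitive_root z -> root G z = P d.
  move=> prim_z; have d0 := prim_order_gt0 prim_z.
  apply/idP/hasP => [Gz|[w]].
    by exists z => //; rewrite mem_roots_of ?root_Cyclotomic.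
  by rewrite mem_roots_of ?root_Cyclotomic // => prim_w;
    rewrite (root_primitive_eq g prim_z prim_w).
pose F := \prod_(d <- divisors n | P d) Phi d.
have dvF : F %| 'X^n - 1.
  have -> : 'X^n - 1 = \prod_(d <- divisors n) Phi d.
    by rewrite -rmorph_prod /= prod_Cyclotomic // rmorphB /= map_polyXn rmorph1.
  by rewrite [X in _ %| X](bigID P) /= dvdp_mulr.
have [G0 F0] := (dvdpN0 dvG XnN0, dvdpN0 dvF XnN0).
(* G and F may differ by a constant factor, so roots are compared instead; both divide the separable
   X^n - 1, so membership suffices. *)
have permGF : perm_eq (roots_of G) (roots_of F).
  apply: uniq_perm; rewrite ?uniq_roots_of ?(dvdp_separable _ sepXn) // => z.
  rewrite !mem_roots_of // [root F z]/root horner_prod prodf_seq_eq0;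
    apply/idP/hasP.
    move=> Gz; have zn1 : z ^+ n = 1.
      have := dvdp_trans (_ : 'X - z%:P %| G) dvG.
      rewrite !dvdp_XsubCl => /(_ Gz); rewrite /root !hornerE subr_eq0 => /eqP.
      by [].
    have [d prim_z dn] := prim_order_exists n0 zn1.
    exists d; first by rewrite -dvdn_divisors.
    by rewrite -(rootGE d z) // Gz -/(root _ _) root_Cyclotomic ?(dvdn_gt0 n0).
  case=> d; rewrite -dvdn_divisors // => dn /andP[Pd].
  by rewrite -/(root _ _) root_Cyclotomic ?(dvdn_gt0 n0) // => /rootGE->.
have psumG k : (0 < k)%N ->
    inv_psum k G = (\sum_(d <- divisors n | P d) ramanujan k d)%:~R.
  move=> k0; rewrite /inv_psum (perm_big _ permGF) -/(inv_psum k F)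
    inv_psum_prod //.
  rewrite rmorph_sum big_seq_cond [RHS]big_seq_cond;
    apply: eq_bigr => d /andP[].
  by rewrite -dvdn_divisors // => dn _;
    rewrite inv_psum_Cyclotomic ?(dvdn_gt0 n0 dn).
have g0 : G`_0 != 0.
  have : h`_0 * g`_0 != 0.
    by rewrite -coef0M -Dh coefB coefXn coef1 (ltn_eqF n0) sub0r oppr_eq0
      oner_eq0.
  by rewrite mulf_eq0 negb_or coef_map /= intr_eq0 => /andP[].
move=> r; apply: (@intr_inj algC).
rewrite -coef_map -deriv_map coef_deriv_inv_psum // rmorphN rmorph_sum /=.
congr (- _); apply: eq_bigr => i _; rewrite rmorphM /= psumG //.
by rewrite coef_map.
Qed.

(** * Growth of sequences satisfying the recursive inequality *)

(** The conclusion is multiplied by D to avoid the exponent j - 1 at j = 0. One c, chosen before D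
    and a, serves all j <= r, since the recursion reaches back to every earlier term. *)
Lemma log_deriv_recursion_bound (R : realFieldType) (K : nat -> R) (r : nat) :
  (forall i, 0 <= K i) ->
  exists2 c, 0 <= c & forall (D : R) (a : nat -> R), 1 <= D ->
    (forall j, 0 <= a j) -> a 0%N <= 1 ->
    (forall j, j.+1%:R * a j.+1 <=
       (D + 1) / 2 * a j + \sum_(i < j) K i * D * a (j - i.+1)%N) ->
    forall j, (j <= r)%N ->
      D * a j <= D ^+ j.+1 / (2 ^+ j * j`!%:R) + c * D ^+ j.
Proof.
move=> K0; elim: r => [|r [c c0 IHr]].
  exists 0 => // D a D1 a_ge0 a0 _ j; rewrite leqn0 => /eqP->.
  by rewrite mul0r addr0 expr0 mul1r divr1 expr1 ler_piMr ?(le_trans ler01 D1).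
pose S := \sum_(i < r) K i; have S0 : 0 <= S by apply: sumr_ge0.
(* S (1 + c) pays for the tail and c + 1 for the lower-order part of the head; the total is at least
   c, as the indices j <= r require. *)
exists (S * (1 + c) + c + 1) => [|D a D1 a_ge0 a0 rec j].
  by rewrite !addr_ge0 // mulr_ge0 // addr_ge0.
have D0 : 0 <= D := le_trans ler01 D1.
have {}IHr := IHr D a D1 a_ge0 a0 rec.
rewrite leq_eqVlt => /predU1P[->|]; last first.
  rewrite ltnS => jr; apply: (le_trans (IHr j jr)).
  rewrite lerD2l ler_wpM2r ?exprn_ge0 //.
  have : 0 <= S * (1 + c) by rewrite mulr_ge0 // addr_ge0.
  by lra.
have weight_le1 k : (2 ^+ k * k`!%:R : R)^-1 <= 1.
  rewrite invf_le1 ?mulr_gt0 ?exprn_gt0 ?ltr0n ?fact_gt0 //.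
  by rewrite mulr_ege1 ?exprn_ege1 ?ler1n ?fact_gt0.
(* Indices here are at most r - 1, so D times each term of a is at most (1 + c) D^r; the tail stays
   one order below D^(r+2). *)
have tail : D * \sum_(i < r) K i * D * a (r - i.+1)%N <= S * (1 + c) * D ^+
  r.+1.
  rewrite mulr_sumr /S !mulr_suml; apply: ler_sum => i _.
  have -> : D * (K i * D * a (r - i.+1)%N) = K i * (D * (D * a (r - i.+1)%N))
    by ring.
  rewrite -!mulrA ler_wpM2l // exprS [leRHS]mulrCA ler_wpM2l //.
  apply: (le_trans (IHr _ (leq_subr _ _))); rewrite mulrDl mul1r lerD //.
    apply: le_trans (ler_piMr _ (weight_le1 _)) _; rewrite ?exprn_ge0 //.
    by rewrite ler_weXn2l // subnSK // leq_subr.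
  by rewrite ler_wpM2l // ler_weXn2l // leq_subr.
(* The factor (D + 1) / 2 supplies the new 1/2 in the main term; as D >= 1, the rest fits into (c +
   1) D^(r+1). *)
have head : D * ((D + 1) / 2 * a r) <=
    D ^+ r.+2 / (2 ^+ r.+1 * r`!%:R) + (c + 1) * D ^+ r.+1.
  have -> : D * ((D + 1) / 2 * a r) = (D + 1) / 2 * (D * a r) by ring.
  have half0 : 0 <= (D + 1) / 2 by lra.
  apply: (le_trans (ler_wpM2l half0 (IHr r (leqnn r)))).
  rewrite [2 ^+ r.+1]exprS -[2 * _ * _]mulrA [(2 * _)^-1]invfM.
  move: (weight_le1 r); set u := (_ * _)^-1 => u1; rewrite !exprS;
    set X := D ^+ r.
  have X0 : 0 <= X by rewrite exprn_ge0.
  have h0 : 0 <= D * X by rewrite mulr_ge0.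
  have h1 : D * X * u <= D * X by rewrite ler_piMr.
  have h2 : c * X <= c * X * D by rewrite ler_peMr // mulr_ge0.
  lra.
have := ler_wpM2l D0 (rec r); rewrite mulrDr => /le_trans/(_ (lerD head tail))
  main.
rewrite -(ler_pM2l (ltr0Sn R r)).
apply: (@le_trans _ _ (D ^+ r.+2 / (2 ^+ r.+1 * r`!%:R) + (S * (1 + c) + c + 1)
  * D ^+ r.+1)).
  rewrite mulrCA; apply: (le_trans main).
  by lra.
(* The main terms agree because (r + 1) / (r + 1)! = 1 / r!; in the error term the factor r + 1 >= 1
   is simply discarded. *)
rewrite [leRHS]mulrDr lerD //.
  rewrite factS natrM; have rf0 : (r`!%:R : R) != 0 by rewrite pnatr_eq0 -lt0n
    fact_gt0.
  have p0 : (2 ^+ r.+1 : R) != 0 by rewrite expf_neq0 // pnatr_eq0.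
  have r0 : (r.+1%:R : R) != 0 by rewrite pnatr_eq0.
  rewrite le_eqVlt; apply/predU1P; left; move: r0 p0 rf0;
    move: (r.+1%:R) (2 ^+ r.+1) (r`!%:R) => u v w u0 v0 w0.
  by field; rewrite u0 v0 w0.
rewrite ler_peMl ?ler1n // mulr_ge0 ?exprn_ge0 //.
by rewrite !addr_ge0 // mulr_ge0 // addr_ge0.
Qed.

(** * Bounds for the coefficients of divisors of X^n - 1 *)

Lemma zpoly_dvd_coef_recursion (R : realFieldType) (n : nat) (g : {poly int})
  (j : nat) :
  (0 < n)%N -> zpoly_dvd g ('X^n - 1) ->
  (j.+1%:R : R) * (`|(g`_j.+1)%R|%N)%:R <= ((size (divisors n))%:R + 1) / 2 *
    (`|(g`_j)%R|%N)%:R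
    + \sum_(i < j) (\sum_(e < i.+3) e)%:R * (size (divisors n))%:R *
      (`|(g`_(j - i.+1))%R|%N)%:R.
Proof.
move=> n0 gdvd; have [P Pg] := zpoly_dvd_log_deriv n0 gdvd.
have absE (x : int) : (`|x|%N)%:R = `|x%:~R| :> R by rewrite -intr_norm -abszE.
have normg : j.+1%:R * (`|(g`_j.+1)%R|%N)%:R = `|(g^`()`_j)%:~R| :> R.
  by rewrite coef_deriv rmorphMn normrMn absE mulr_natl.
rewrite normg Pg rmorphN normrN rmorph_sum;
  apply: (le_trans (ler_norm_sum _ _ _)).
(* The first term carries a sum of Moebius values, at most (d(n) + 1) / 2. The later term of index i
   + 1 carries the sums c_d(i + 2), hence the range e < i + 3. *)
rewrite big_ord_recl /= subn0 rmorphM normrM absE; apply: lerD.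
  rewrite ler_wpM2r ?normr_ge0 // ler_pdivlMr ?ltr0n // mulr_natr.
  rewrite -intr_norm -rmorphMn natr1 [leRHS]pmulrn ler_int.
  rewrite big_seq_cond (eq_bigr moebius) -?big_seq_cond ?normr_sum_moebius_le
    // => d /andP[].
  by rewrite -dvdn_divisors // => dn _; rewrite ramanujan1 ?(dvdn_gt0 n0 dn).
apply: ler_sum => i _; rewrite rmorphM normrM absE ler_wpM2r ?normr_ge0 //.
rewrite -intr_norm -natrM [leRHS]pmulrn ler_int.
apply: (le_trans (ler_norm_sum _ _ _)); rewrite mulnC PoszM.
rewrite big_mkcond; apply: le_trans
  (_ : \sum_(d <- divisors n) (\sum_(e < i.+3) e)%:Z <= _).
  apply: ler_sum => d _; case: ifP => // _; exact: normr_ramanujan_le.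
by rewrite big_const_seq count_predT iter_addr_0 mulrC -mulr_natr natz.
Qed.

Theorem theorem4p1 (R : realType) (r : nat) (hr : (1 <= r)%N) :
  exists c : R, forall n : nat, (0 < n)%N ->
    (H r n)%:R <= 1 / (2 ^+ r * (r`!)%:R) * (size (divisors n))%:R ^+ r
                  + c * (size (divisors n))%:R ^+ r.-1.
Proof.
have [|c _ bound] := @log_deriv_recursion_bound R
  (fun i => (\sum_(e < i.+3) e)%:R) r.
  by move=> i; rewrite ler0n.
(* The maximum is attained, so it suffices to bound the coefficient of one divisor g. *)
exists c => n n0; have [[g gdvd <-] _] := H_max r n0.
set D : R := (size (divisors n))%:R.
have D1 : 1 <= D.
  rewrite ler1n -has_predT; apply/hasP.
  by exists n; rewrite // -dvdn_divisors.
have D0 := lt_le_trans ltr01 D1.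
have := bound D (fun j => (`|(g`_j)%R|%N)%:R) D1 (fun j => ler0n _ _).
(* The constant terms of g and of its cofactor multiply to -1. *)
have g0 : `|(g`_0)%R|%N = 1%N.
  case: gdvd => h /(congr1 (fun f : {poly int} => `|(f`_0)%R|%N)).
  rewrite coefB coefXn coef1 (ltn_eqF n0) coef0M abszM /= => /esym/eqP.
  by rewrite muln_eq1 => /andP[_ /eqP].
rewrite g0 => /(_ (lexx _))
  /(_ (fun j => zpoly_dvd_coef_recursion R j n0 gdvd)).
move=> /(_ r (leqnn r)) main; rewrite -(ler_pM2l D0); apply: (le_trans main).
(* Both sides carry an extra factor D; in the error term r >= 1 is what lets D^r absorb it. *)
have Dr : D ^+ r = D * D ^+ r.-1 by rewrite -exprS prednK.
by rewrite exprS mulrDr [D * (c * _)]mulrCA -Dr div1r -mulrA [D ^+ r * _]mulrC.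
Qed.
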